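(* Let $l'(\mathbf{x},\mathbf{e})=\sum_{j=1}^m s_j(\mathbf{x})\,e_j$ be the scaled linear part of the roundoff error associated to a polynomial $f$ in $n$ variables, let $d$ be its degree, and let $\mathbf{X}=[0,1]^n$, $\mathbf{E}=[-1,1]^m$ (see context). Put $$\underline{l'}:=\min_{(\mathbf{x},\mathbf{e})\in\mathbf{X}\times\mathbf{E}}l'(\mathbf{x},\mathbf{e}),\qquad \overline{l'}:=\max_{(\mathbf{x},\mathbf{e})\in\mathbf{X}\times\mathbf{E}}l'(\mathbf{x},\mathbf{e}),\qquad l'^*:=\max_{(\mathbf{x},\mathbf{e})\in\mathbf{X}\times\mathbf{E}}|l'(\mathbf{x},\mathbf{e})|,$$ and for each integer $k\geq d$ let $\underline{l'_k}$ and $\overline{l'_k}$ be the optimal values of the linear programs of order $k$ defined in the context. Then, as $k\to+\infty$, $\underline{l'_k}\uparrow\underline{l'}$ and $\overline{l'_k}\downarrow\overline{l'}$ (that is, $(\underline{l'_k})_{k\ge d}$ is nondecreasing and converges to $\underline{l'}$, and $(\overline{l'_k})_{k\ge d}$ is nonincreasing and converges to $\overline{l'}$). In addition, $$l'_k:=\max\{|\underline{l'_k}|,|\overline{l'_k}|\}\ \longrightarrow\ l'^*\qquad\text{as }k\to+\infty.$$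
   Context: Roundoff setting. A program implements a polynomial expression $f\in\mathbb{R}[\mathbf{x}]$, $\mathbf{x}=(x_1,\dots,x_n)$, built from variables and real constants with the operations $+,-,\times$; the input set is $\mathbf{X}=[0,1]^n$. In the simple rounding model, one error variable $e_j$ is introduced for each input variable $x_i$ or constant and for each arithmetic operation: each variable, constant, or result of an operation is multiplied by a factor $(1+e_j)$. With $\mathbf{e}=(e_1,\dots,e_m)$ the vector of all error variables, this yields a polynomial $\hat f(\mathbf{x},\mathbf{e})$ (the rounded expression) with $\hat f(\mathbf{x},\mathbf{0})=f(\mathbf{x})$. The error variables range over $[-\varepsilon,\varepsilon]$, with $\varepsilon>0$ the machine epsilon. Put $r(\mathbf{x},\mathbf{e}):=\hat f(\mathbf{x},\mathbf{e})-f(\mathbf{x})$, $s_j(\mathbf{x}):=\frac{\partial r}{\partial e_j}(\mathbf{x},\mathbf{0})$ for $j=1,\dots,m$, and $l(\mathbf{x},\mathbf{e}):=\sum_{j=1}^m s_j(\mathbf{x})\,e_j$. After dividing each error variable by $\varepsilon$, the scaled linear part $l'=l/\varepsilon$ is $l'(\mathbf{x},\mathbf{e})=\sum_{j=1}^m s_j(\mathbf{x})\,e_j$ with the scaled error variables $\mathbf{e}\in\mathbf{E}=[-1,1]^m$. The integer $d$ is the total degree of $l$ (equivalently of $l'$) as a polynomial in $(\mathbf{x},\mathbf{e})$. Products of constraints. For $j\in\{1,\dots,m\}$ and $\boldsymbol{\alpha}_j=(\boldsymbol{\alpha}_j',\gamma_j)$, $\boldsymbol{\beta}_j=(\boldsymbol{\beta}_j',\delta_j)$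 in $\mathbb{N}^{n+1}$, with $\boldsymbol{\alpha}_j',\boldsymbol{\beta}_j'\in\mathbb{N}^n$ and $\gamma_j,\delta_j\in\mathbb{N}$, let $$h_{\boldsymbol{\alpha}_j,\boldsymbol{\beta}_j}(\mathbf{x},\mathbf{e}):=\mathbf{x}^{\boldsymbol{\alpha}_j'}(\mathbf{1}-\mathbf{x})^{\boldsymbol{\beta}_j'}\Bigl(\tfrac12+\tfrac{e_j}{2}\Bigr)^{\gamma_j}\Bigl(\tfrac12-\tfrac{e_j}{2}\Bigr)^{\delta_j},$$ where $\mathbf{x}^{\boldsymbol{\alpha}'}=\prod_{i=1}^n x_i^{\alpha'_i}$ and $(\mathbf{1}-\mathbf{x})^{\boldsymbol{\beta}'}=\prod_{i=1}^n(1-x_i)^{\beta'_i}$. For a multi-index, $|\boldsymbol{\alpha}|$ denotes the sum of its entries. (This polynomial depends on the index $j$ through $e_j$.) Linear programs. For each integer $k\geq d$, $$\underline{l'_k}:=\max_{t,\lambda_{\boldsymbol{\alpha}_j,\boldsymbol{\beta}_j}}\ t\quad\text{s.t.}\quad l'-t=\sum_{j=1}^m\phi_j,\quad \phi_j=\sum_{|\boldsymbol{\alpha}_j+\boldsymbol{\beta}_j|\leq k}\lambda_{\boldsymbol{\alpha}_j,\boldsymbol{\beta}_j}h_{\boldsymbol{\alpha}_j,\boldsymbol{\beta}_j}\ (j=1,\dots,m),\quad \lambda_{\boldsymbol{\alpha}_j,\boldsymbol{\beta}_j}\geq 0\ (j=1,\dots,m),$$ where $t\in\mathbb{R}$, the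 weights $\lambda_{\boldsymbol{\alpha}_j,\boldsymbol{\beta}_j}$ are real variables indexed by $j$ and by the pairs $(\boldsymbol{\alpha}_j,\boldsymbol{\beta}_j)\in\mathbb{N}^{n+1}\times\mathbb{N}^{n+1}$ with $|\boldsymbol{\alpha}_j+\boldsymbol{\beta}_j|\leq k$, and equalities are identities of polynomials in $(\mathbf{x},\mathbf{e})$. The value $\overline{l'_k}$ is defined by the same program with $\max$ replaced by $\min$ and $l'-t$ replaced by $t-l'$. *)

(* Defs.v *)
From mathcomp Require Import all_boot all_order all_algebra.
From mathcomp Require Import mpoly.
From mathcomp Require Import classical_sets reals.

Set Implicit Arguments.
Unset Strict Implicit.
Unset Printing Implicit Defensive.

Import GRing.Theory.
Local Open Scope ring_scope.

Inductive binop := OpAdd | OpSub | OpMul.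

(* Programs with input variables x_1, ..., x_n and p constants, whose values    *)
(* are a separate map c : 'I_p -> R. There is one error per index in 'I_n and  *)
(* 'I_p, shared by all occurrences of that variable or constant; occurrences   *)
(* of a constant with separate errors are given different indices.             *)
Inductive expr (n p : nat) :=
  | Var of 'I_n
  | Cst of 'I_p
  | Bin of binop & expr n p & expr n p.

Fixpoint nops n p (f : expr n p) : nat :=
  if f is Bin _ a b then (nops a + nops b).+1 else 0.

Definition nerr n p (f : expr n p) : nat := n + p + nops f.

Section Semantics.
Variables (A : pzRingType) (n p : nat).

Definition binop_sem (o : binop) (a b : A) : A :=
  match o with OpAdd => a + b | OpSub => a - b | OpMul => a * b end.

Fixpoint exact (x : 'I_n -> A) (c : 'I_p -> A) (f : expr n p) : A :=
  match f with
  | Var i => x i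
  | Cst k => c k
  | Bin o a b => binop_sem o (exact x c a) (exact x c b)
  end.

(* ex, ec, eo are the errors of the variables, the constants and the           *)
(* operations; the operations are numbered in prefix order (root first).       *)
Fixpoint rounded (x ex : 'I_n -> A) (c ec : 'I_p -> A) (f : expr n p) :
    ('I_(nops f) -> A) -> A :=
  match f return ('I_(nops f) -> A) -> A with
  | Var i => fun _ => x i * (1 + ex i)
  | Cst k => fun _ => c k * (1 + ec k)
  | Bin o a b => fun eo =>
      binop_sem o
        (rounded x ex c ec (fun i => eo (lift ord0 (lshift (nops b) i))))
        (rounded x ex c ec (fun i => eo (lift ord0 (rshift (nops a) i))))
      * (1 + eo ord0)
  end.

End Semantics.

(* In {mpoly R[n + m]} the first n variables are x, the last m are e. *)

Section LinearPart.
Variables (R : realType) (n p : nat) (c : 'I_p -> R) (f : expr n p).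
Let m := nerr f.

Definition xvar (i : 'I_n) : {mpoly R[n + m]} := 'X_(lshift m i).
Definition evar (j : 'I_m) : {mpoly R[n + m]} := 'X_(rshift n j).

Definition exact_poly : {mpoly R[n]} :=
  exact (fun i => 'X_i) (fun k => (c k)%:MP) f.

Definition rounded_poly : {mpoly R[n + m]} :=
  rounded xvar (fun i => evar (lshift (nops f) (lshift p i)))
    (fun k => (c k)%:MP) (fun k => evar (lshift (nops f) (rshift n k)))
    (fun o => evar (rshift (n + p) o)).

Definition of_x (q : {mpoly R[n]}) : {mpoly R[n + m]} :=
  q \mPo [tuple xvar i | i < n].

Definition at_e0 (q : {mpoly R[n + m]}) : {mpoly R[n]} :=
  q \mPo [tuple (if split i is inl i' then 'X_i' else 0) | i < n + m].

Definition roundoff : {mpoly R[n + m]} := rounded_poly - of_x exact_poly.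

Definition sens (j : 'I_m) : {mpoly R[n]} := at_e0 (roundoff^`M(rshift n j)).

(* This is l, and also l' once the error variables have been divided by the    *)
(* machine epsilon: l and l' are the same polynomial, only the range of e      *)
(* differs.                                                                    *)
Definition linpart : {mpoly R[n + m]} := \sum_(j < m) of_x (sens j) * evar j.

End LinearPart.

Section Optimization.
Variables (R : realType) (n m : nat) (l : {mpoly R[n + m]}).

Definition is_max (S : set R) (v : R) : Prop := S v /\ ubound S v.
Definition is_min (S : set R) (v : R) : Prop := S v /\ lbound S v.

Definition box : set ('I_(n + m) -> R) :=
  [set v | (forall i : 'I_n, 0 <= v (lshift m i) <= 1) /\
           (forall j : 'I_m, -1 <= v (rshift n j) <= 1)].

Definition box_values : set R := [set l.@[v] | v in box].
Definition box_abs_values : set R := [set `|l.@[v]| | v in box].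

Definition l_min : R := inf box_values.
Definition l_max : R := sup box_values.
Definition l_absmax : R := sup box_abs_values.

(* The degree of the zero polynomial is 0 by convention. *)
Definition degree : nat := (msize l).-1.

(* Multi-indices (alpha', gamma) are monomials in n + 1 variables, gamma being *)
(* the last exponent.                                                          *)
Definition hprod (j : 'I_m) (a b : 'X_{1..n + 1}) : {mpoly R[n + m]} :=
  (\prod_(i < n) 'X_(lshift m i) ^+ a (lshift 1 i)) *
  (\prod_(i < n) (1 - 'X_(lshift m i)) ^+ b (lshift 1 i)) *
  ((2^-1)%:MP + 2^-1 *: 'X_(rshift n j)) ^+ a (rshift n ord0) *
  ((2^-1)%:MP - 2^-1 *: 'X_(rshift n j)) ^+ b (rshift n ord0).

Definition weights := 'I_m -> 'X_{1..n + 1} -> 'X_{1..n + 1} -> R.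

Definition weights_ge0 (k : nat) (lam : weights) : Prop :=
  forall j (a b : 'X_{1..n + 1}), (mdeg (a + b)%MM <= k)%N -> 0 <= lam j a b.

(* The bounds on the types of a and b only make the index set finite: they are *)
(* implied by |a + b| <= k.                                                    *)
Definition phi (k : nat) (lam : weights) (j : 'I_m) : {mpoly R[n + m]} :=
  \sum_(a : bmultinom (n + 1) k.+1)
    \sum_(b : bmultinom (n + 1) k.+1 | (mdeg (a + b)%MM <= k)%N)
      lam j a b *: hprod j a b.

Definition lp_lower_set (k : nat) : set R :=
  [set t | exists lam : weights,
     weights_ge0 k lam /\ l - t%:MP = \sum_(j < m) phi k lam j].

Definition lp_upper_set (k : nat) : set R :=
  [set t | exists lam : weights,
     weights_ge0 k lam /\ t%:MP - l = \sum_(j < m) phi k lam j].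

Definition lp_lower (k : nat) : R := sup (lp_lower_set k).
Definition lp_upper (k : nat) : R := inf (lp_upper_set k).
Definition lp_abs (k : nat) : R := Num.max `|lp_lower k| `|lp_upper k|.

End Optimization.

(* Main.v *)
(* Writing [s_j = \sum_nu c_(j, nu) B_nu] in the Bernstein basis of degree [D] in
   each variable, whose members are nonnegative and sum to 1, gives
     l - t = \sum_nu (\sum_j (|c_(j, nu)| + c_(j, nu) e_j)
                      + (- t - \sum_j |c_(j, nu)|)) B_nu.
   Each [|c| + c e_j] is a nonnegative multiple of [1/2 + e_j/2] or of
   [1/2 - e_j/2], and [c_(j, nu)] is within [O(1/D)] of [s_j] at the grid point
   [nu / D], where [- \sum_j |s_j|] is the minimum of [l] over the errors.  So
   [t = l_min - O(1/D)] is feasible at order [n D + 1], which gives the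
   convergence without any general Positivstellensatz. *)
Require Import Defs.
From mathcomp Require Import all_boot all_order all_algebra.
From mathcomp Require Import mpoly.
From mathcomp Require Import all_classical all_reals all_analysis.
Import numFieldNormedType.Exports.
From mathcomp Require Import ring lra zify.
Set Implicit Arguments.
Unset Strict Implicit.
Unset Printing Implicit Defensive.
Import Order.TTheory GRing.Theory Num.Theory.
Local Open Scope classical_set_scope.
Local Open Scope ring_scope.

(** * The sparse cone *)

Section Cone.
Variables (R : realType) (n m : nat).
Implicit Types (q : {mpoly R[n + m]}) (j : 'I_m).
Implicit Types (a b : 'X_{1..n + 1}) (k : nat).

(** By conversion, [lp_lower_set l k t] is [sparse_cone k (l - t%:MP)], so feasibility becomes
    membership in a convex cone. *)
Definition sparse_cone k q := exists lam : weights R n m,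
  weights_ge0 k lam /\ q = \sum_(j < m) phi k lam j.

Lemma phiD k (lam1 lam2 : weights R n m) j :
  phi k (fun j a b => lam1 j a b + lam2 j a b) j = phi k lam1 j + phi k lam2 j.
Proof.
rewrite /phi -big_split /=; apply: eq_bigr => a _.
by rewrite -big_split /=; apply: eq_bigr => b _; rewrite scalerDl.
Qed.

Lemma phiZ k c (lam : weights R n m) j :
  phi k (fun j a b => c * lam j a b) j = c *: phi k lam j.
Proof.
rewrite /phi scaler_sumr; apply: eq_bigr => a _.
by rewrite scaler_sumr; apply: eq_bigr => b _; rewrite scalerA.
Qed.

Lemma sparse_cone0 k : sparse_cone k 0.
Proof.
exists (fun _ _ _ => 0); split=> //; rewrite big1 // => j _.
by rewrite /phi big1 // => a _; rewrite big1 // => b _; rewrite scale0r.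
Qed.

Lemma sparse_coneD k q1 q2 :
  sparse_cone k q1 -> sparse_cone k q2 -> sparse_cone k (q1 + q2).
Proof.
move=> [l1 [l1_ge0 ->]] [l2 [l2_ge0 ->]].
exists (fun j a b => l1 j a b + l2 j a b); split=> [j a b lek|].
  by rewrite addr_ge0 ?l1_ge0 ?l2_ge0.
by rewrite -big_split /=; apply: eq_bigr => j _; rewrite phiD.
Qed.

Lemma sparse_coneZ k c q : 0 <= c -> sparse_cone k q -> sparse_cone k (c *: q).
Proof.
move=> c_ge0 [l [l_ge0 ->]]; exists (fun j a b => c * l j a b).
split=> [j a b lek|]; first by rewrite mulr_ge0 ?l_ge0.
by rewrite scaler_sumr; apply: eq_bigr => j _; rewrite phiZ.
Qed.

Lemma sparse_cone_sum k (I : Type) (r : seq I) (P : pred I) F :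
  (forall i, P i -> sparse_cone k (F i)) ->
  sparse_cone k (\sum_(i <- r | P i) F i).
Proof.
move=> FP; apply: big_ind => //; first exact: sparse_cone0.
exact: sparse_coneD.
Qed.

Lemma sparse_cone_hprod k j a b :
  (mdeg (a + b)%MM <= k)%N -> sparse_cone k (hprod R j a b).
Proof.
move=> lek; have [alt blt] : (mdeg a < k.+1)%N /\ (mdeg b < k.+1)%N.
  by move: lek; rewrite mdegD; lia.
exists (fun j' a' b' => ((j' == j) && (a' == a) && (b' == b))%:R).
split=> [j' a' b' _|]; first exact: ler0n.
rewrite (bigD1 j) //= [X in _ + X]big1 => [|j' /negPf nj]; last first.
  by rewrite /phi big1 // => a' _; rewrite big1 // => b' _; rewrite nj scale0r.
rewrite addr0 /phi (bigD1 (BMultinom alt)) //= [X in _ + X]big1; last first.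
  move=> a' na; rewrite big1 // => b' _.
  have /negPf-> : bmnm a' != a := na.
  by rewrite andbF scale0r.
rewrite addr0 (bigD1 (BMultinom blt)) //= big1 ?addr0 => [|b' /andP[_ nb]].
  by rewrite !eqxx scale1r.
have /negPf-> : bmnm b' != b := nb.
by rewrite andbF scale0r.
Qed.

(** The weights cannot simply be reused, since [weights_ge0 k] says nothing of them past order [k];
    the combination is rebuilt from its generators. *)
Lemma sparse_cone_le k k' q :
  (k <= k')%N -> sparse_cone k q -> sparse_cone k' q.
Proof.
move=> lekk' [l [l_ge0 ->]]; apply: sparse_cone_sum => j _.
apply: sparse_cone_sum => a _; apply: sparse_cone_sum => b leab.
by apply: sparse_coneZ; [exact: l_ge0|apply/sparse_cone_hprod/(leq_trans leab)].
Qed.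

Lemma meval_hprod (v : 'I_(n + m) -> R) j a b :
  (hprod R j a b).@[v] =
    (\prod_(i < n) v (lshift m i) ^+ a (lshift 1 i)) *
    (\prod_(i < n) (1 - v (lshift m i)) ^+ b (lshift 1 i)) *
    (2^-1 + 2^-1 * v (rshift n j)) ^+ a (rshift n ord0) *
    (2^-1 - 2^-1 * v (rshift n j)) ^+ b (rshift n ord0).
Proof.
rewrite /hprod !(mevalM, rmorphXn, rmorph_prod) /= mevalD mevalB mevalZ mevalXU.
rewrite mevalC; congr (_ * _ * _ * _); apply: eq_bigr => i _.
  by rewrite rmorphXn /= mevalXU.
by rewrite rmorphXn /= mevalB meval1 mevalXU.
Qed.

(** Every factor of a generator is nonnegative on the box. Hence a feasible [t] is a lower bound of
    the polynomial there. *)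
Lemma sparse_cone_ge0 k q v : sparse_cone k q -> box v -> 0 <= q.@[v].
Proof.
move=> [l [l_ge0 ->]] [vx ve]; rewrite raddf_sum sumr_ge0 //= => j _.
rewrite raddf_sum sumr_ge0 //= => a _; rewrite raddf_sum sumr_ge0 //= => b leab.
rewrite mevalZ mulr_ge0 ?l_ge0 // meval_hprod; have := ve j => vj.
rewrite !mulr_ge0 // ?exprn_ge0 //; try lra.
  by apply: prodr_ge0 => i _; rewrite exprn_ge0 //; case/andP: (vx i).
by apply: prodr_ge0 => i _; rewrite exprn_ge0 // subr_ge0; case/andP: (vx i).
Qed.

(** Here [x], [1 - x], [1/2 + e/2] and [1/2 - e/2] all equal [1/2], so every generator of order [k]
    is at least [2^-k]; this is what bounds the multipliers of the linear programs. *)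
Definition box_center (i : 'I_(n + m)) : R :=
  if fintype.split i is inl _ then 2^-1 else 0.

Lemma box_centerl i : box_center (lshift m i) = 2^-1.
Proof. by rewrite /box_center (unsplitK (inl i)). Qed.

Lemma box_centerr j : box_center (rshift n j) = 0.
Proof. by rewrite /box_center (unsplitK (inr j)). Qed.

Lemma box_center_box : box box_center.
Proof. by split=> i; rewrite ?box_centerl ?box_centerr; lra. Qed.

Lemma meval_hprod_center j a b :
  (hprod R j a b).@[box_center] = 2^-1 ^+ mdeg (a + b)%MM.
Proof.
rewrite meval_hprod mdegD !mdegE !big_split_ord !big_ord1 /= box_centerr.
rewrite mulr0 addr0 subr0 !exprD -!prodrXr.
under eq_bigr do rewrite box_centerl.
under [X in _ * X * _ * _]eq_bigr do rewrite box_centerl.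
have -> : 1 - 2^-1 = 2^-1 :> R by lra.
ring.
Qed.

End Cone.

(** * Attainment *)

Section Attainment.
Variable R : realType.

Lemma continuous_meval N (q : {mpoly R[N]}) :
  continuous (fun v : {ptws 'I_N -> R} => q.@[v]).
Proof.
have mon_cont (u : 'X_{1..N}) :
    continuous (fun v : {ptws 'I_N -> R} => \prod_(i < N) v i ^+ u i).
  apply: (@continuous_big R _ *%R _ _ (@mul_continuous R)) => i _ v.
  exact: (continuous_comp (@proj_continuous _ _ i v) (@exprn_continuous _ _ _)).
have -> : (fun v : {ptws 'I_N -> R} => q.@[v]) = fun v : {ptws 'I_N -> R} =>
    \sum_(u <- msupp q) q@_u * \prod_(i < N) v i ^+ u i.
  by apply/funext => w; rewrite mevalE.
apply: (@continuous_big R _ +%R _ _ (@add_continuous R)) => u _ v.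
exact: (cvgM (cvg_cst _) (mon_cont u v)).
Qed.

(** In the product topology the box is a product of segments, so Tychonoff's theorem applies. *)
Lemma box_compact n m : compact (@box R n m : set {ptws 'I_(n + m) -> R}).
Proof.
rewrite [X in compact X](_ : _ = [set v : {ptws 'I_(n + m) -> R} | forall i,
  `[if fintype.split i is inl _ then 0 else -1, 1]%classic (v i)]); last first.
  apply/seteqP; split=> v /=.
    move=> [vx ve] i; rewrite in_itv /=; case: split_ordP => j ->.
      exact: vx.
    exact: ve.
  move=> vP; split=> j.
    by have := vP (lshift m j); rewrite (unsplitK (inl j)) in_itv.
  by have := vP (rshift n j); rewrite (unsplitK (inr j)) in_itv.
exact: (@tychonoff _ (fun=> R) _ (fun i => @segment_compact R _ 1)).
Qed.

Lemma box_maximum n m (q : {mpoly R[n + m]}) :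
  exists2 v, box v & forall w, box w -> q.@[w] <= q.@[v].
Proof.
have [|v] := compact_EVT_max _ (@box_compact n m)
  (continuous_subspaceT (@continuous_meval _ q)).
  by exists (@box_center R n m); exact: box_center_box.
by rewrite inE => vB vmax; exists v => // w wB; apply: vmax; rewrite inE.
Qed.

(** * Optimal solutions of finite linear programs *)

Section FiniteProgram.
Variables (I : finType) (P : pred I) (N : nat).
Variables (h : I -> {mpoly R[N]}) (q : {mpoly R[N]}) (w : 'I_N -> R) (eps : R).
Hypothesis eps_gt0 : 0 < eps.
Hypothesis h_ge : forall i, P i -> eps <= (h i).@[w].

Definition program_set : set R := [set t | exists lam : I -> R,
  (forall i, P i -> 0 <= lam i) /\ q - t%:MP = \sum_(i | P i) lam i *: h i].

Lemma meval_program t (lam : I -> R) :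
  q - t%:MP = \sum_(i | P i) lam i *: h i ->
  t = q.@[w] - \sum_(i | P i) lam i * (h i).@[w].
Proof.
move=> /(congr1 (meval w)); rewrite mevalB mevalC raddf_sum /=.
under eq_bigr do rewrite mevalZ.
by move=> <-; rewrite opprB addrC subrK.
Qed.

(* Evaluating at [w] bounds the multipliers of any [t >= t0] by [M] and recovers
   [t] from them, so a continuous function is maximized over a compact set. *)
Lemma program_set_max : program_set !=set0 ->
  exists2 t, program_set t & ubound program_set t.
Proof.
move=> [t0 t0P].
(* For [t >= t0], evaluation at [w] gives [lam i * eps <= q.@[w] - t0] for each multiplier, whence
   this bound. *)
pose M := (q.@[w] - t0) / eps.
pose A : set {ptws I -> R} := [set lam | (forall i, `[0, M]%classic (lam i))].
(* Equality of all coefficients but the constant one, which only fixes [t]: a closed condition on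
   the multipliers alone. *)
pose B : set {ptws I -> R} := \bigcap_(u in [set u | u != 0%MM])
  [set lam | \sum_(i | P i) lam i * (h i)@_u = q@_u].
pose g (lam : {ptws I -> R}) := q.@[w] - \sum_(i | P i) lam i * (h i).@[w].
have lin_cont (c : I -> R) :
    continuous (fun lam : {ptws I -> R} => \sum_(i | P i) lam i * c i).
  apply: (@continuous_big R _ +%R _ _ (@add_continuous R)) => i _ lam.
  have pr : (fun l : {ptws I -> R} => l i) @ lam --> lam i.
    exact: (@proj_continuous I (fun=> R) i lam).
  by have := cvgM pr (cvg_cst (c i)); apply.
have g_cont : continuous g.
  move=> lam.
  by have := cvgB (cvg_cst q.@[w]) (lin_cont (fun i => (h i).@[w]) lam); apply.
have AB_compact : compact (A `&` B).
  apply: compact_closedI; first exact: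
    (@tychonoff _ (fun=> R) _ (fun=> @segment_compact R 0 M)).
  apply: closed_bigI => u _.
  have /continuous_closedP := lin_cont (fun i => (h i)@_u).
  by move=> /(_ [set x | x = q@_u]); apply; exact: closed_eq.
have AB_g lam : (A `&` B) lam -> program_set (g lam).
  move=> [lamA lamB]; exists lam; split=> [i _|].
    by have := lamA i; rewrite /= in_itv => /andP[].
  suff [c qc] : exists c, q - c%:MP = \sum_(i | P i) lam i *: h i.
    by rewrite /g -(meval_program qc).
  exists (q@_0 - \sum_(i | P i) lam i * (h i)@_0).
  apply/mpolyP => u; rewrite mcoeffB mcoeffC [RHS]raddf_sum /=.
  under [RHS]eq_bigr do rewrite mcoeffZ.
  have [->|u_neq0] := eqVneq u 0%MM; first by rewrite mulr1 subKr.
  by rewrite mulr0 subr0 lamB.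
have AB_ge t : program_set t -> t0 <= t ->
    exists2 lam, (A `&` B) lam & t = g lam.
  move=> [lam [lam_ge0 tE]] le_t.
  (* Outside [P] the multipliers are arbitrary; they are set to [0] to stay in the cube [A]. *)
  pose lam' i := if P i then lam i else 0.
  have tE' : q - t%:MP = \sum_(i | P i) lam' i *: h i.
    by rewrite tE; apply: eq_bigr => i Pi; rewrite /lam' Pi.
  exists lam'; last exact: meval_program.
  have M_ge0 : 0 <= M.
    rewrite divr_ge0 ?(ltW eps_gt0) // subr_ge0 (le_trans le_t) //.
    rewrite (meval_program tE) gerBl sumr_ge0 // => i Pi.
    by rewrite mulr_ge0 ?lam_ge0 // (le_trans (ltW eps_gt0)) ?h_ge.
  split=> [i|u /= u_neq0].
    rewrite /lam' /= in_itv /=; case: ifP => [Pi|_]; last by rewrite lexx.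
    rewrite lam_ge0 //= ler_pdivlMr //.
    have -> : q.@[w] = t + \sum_(i | P i) lam i * (h i).@[w].
      by rewrite [in RHS](meval_program tE) subrK.
    rewrite lerBrDr addrC lerD // (bigD1 i) //=.
    rewrite -[lam i * eps]addr0 lerD //.
      by rewrite ler_wpM2l ?lam_ge0 ?h_ge.
    rewrite sumr_ge0 // => j /andP[Pj _].
    by rewrite mulr_ge0 ?lam_ge0 // (le_trans (ltW eps_gt0)) ?h_ge.
  move/(congr1 (mcoeff u)): tE'.
  rewrite mcoeffB mcoeffC (negPf u_neq0) mulr0 subr0 raddf_sum /= => ->.
  by apply: eq_bigr => i _; rewrite mcoeffZ.
have [lam0 lam0AB t0E] := AB_ge _ t0P (lexx t0).
have [|lam] := compact_EVT_max _ AB_compact (continuous_subspaceT g_cont).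
  by exists lam0.
rewrite inE => lamAB lam_max; exists (g lam); first exact: AB_g.
have t0_le : t0 <= g lam by rewrite t0E lam_max // inE.
move=> t tP; have [/(AB_ge _ tP)[lam' lam'AB ->]|/ltW t_lt] := leP t0 t.
  by rewrite lam_max // inE.
exact: le_trans t0_le.
Qed.

End FiniteProgram.
End Attainment.

(** * Bernstein expansions *)

Section Bernstein.
Variable R : realType.

(** Both sides are the trinomial coefficient [(a + N)! / (a! i! (N - i)!)]. *)
Lemma mul_bin_trinomial a i N : (i <= N)%N ->
  ('C(a + N, a + i) * 'C(a + i, a) = 'C(a + N, a) * 'C(N, i))%N.
Proof.
move=> le_iN; apply/eqP; rewrite -(eqn_pmul2r (fact_gt0 (N - i))).
rewrite -(eqn_pmul2r (fact_gt0 a)) -(eqn_pmul2r (fact_gt0 i)); apply/eqP.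
have f1 := bin_fact (leq_add (leqnn a) le_iN); rewrite subnDl in f1.
have f2 := bin_fact (leq_addr i a); rewrite addKn in f2.
have f3 := bin_fact (leq_addr N a); rewrite addKn in f3.
have f4 := bin_fact le_iN.
transitivity (a + N)`!; first by rewrite -f1 -f2; ring.
by rewrite -f3 -f4; ring.
Qed.

(** The coefficient of the monomial of degree [a] on the Bernstein polynomial of degree [D] and
    index [v]; it vanishes for [v < a]. *)
Definition bernstein_coef (D a v : nat) : R := 'C(v, a)%:R / 'C(D, a)%:R.

(** Expand [x ^+ a * (x + (1 - x)) ^+ (D - a)] by the binomial theorem. *)
Lemma exprn_bernstein (A : comAlgType R) (x : A) (D a : nat) : (a <= D)%N ->
  x ^+ a = \sum_(v < D.+1) (bernstein_coef D a v * 'C(D, v)%:R) *: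
                           (x ^+ v * (1 - x) ^+ (D - v)).
Proof.
move=> /subnKC <-; move: (D - a)%N => N.
rewrite -addnS big_split_ord /= big1 ?add0r => [|v _]; last first.
  by rewrite /bernstein_coef bin_small // !mul0r scale0r.
rewrite -[LHS]mulr1 -[in LHS](expr1n A N) -[in LHS](subrK x 1) exprDn mulr_sumr.
apply: eq_bigr => i _; rewrite subnDl -mulrnAr -scaler_nat.
have le_iN : (i <= N)%N by rewrite -ltnS.
rewrite exprD -mulrA [x ^+ i * _]mulrC -!scalerAr; congr (_ *: _).
rewrite /bernstein_coef mulrAC -natrM mulnC mul_bin_trinomial // natrM mulrC.
by rewrite mulKf // pnatr_eq0 -lt0n bin_gt0 leq_addr.
Qed.

Lemma bernstein_coef_itv D a v : (v <= D)%N -> (a <= D)%N ->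
  0 <= bernstein_coef D a v <= 1.
Proof.
move=> le_vD le_aD; rewrite divr_ge0 ?ler0n //=.
by rewrite ler_pdivrMr ?ltr0n ?bin_gt0 // mul1r ler_nat leq_bin2l.
Qed.

(** Iterated, this makes the coefficient a product of ratios [(v - b) / (D - b)] for [b < a], each
    close to [v / D]. Truncated subtraction is harmless: for [v <= a] both sides are [0]. *)
Lemma bernstein_coefS D a v : (a < D)%N ->
  bernstein_coef D a.+1 v = bernstein_coef D a v * ((v - a)%:R / (D - a)%:R).
Proof.
move=> lt_aD; rewrite /bernstein_coef.
have binS w : 'C(w, a.+1)%:R = (w - a)%:R * 'C(w, a)%:R / a.+1%:R :> R.
  by rewrite -natrM -mul_bin_left natrM mulrAC divff ?mul1r // pnatr_eq0.
have Da_neq0 : (D - a)%:R != 0 :> R by rewrite pnatr_eq0 subn_eq0 -ltnNge.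
have Ca_neq0 : 'C(D, a)%:R != 0 :> R by rewrite pnatr_eq0 -lt0n bin_gt0 ltnW.
by rewrite !binS; field; rewrite Da_neq0 Ca_neq0 /= addrC natr1 pnatr_eq0.
Qed.

(** For [v >= a] the difference is [- (a / D) * ((D - v) / (D - a))], whose last factor is at most
    [1]; for [v < a] the truncated ratio is [0] and [v / D <= a / D]. *)
Lemma ratio_approx D a v : (v <= D)%N -> (a < D)%N ->
  `|(v - a)%:R / (D - a)%:R - v%:R / D%:R| <= a%:R / D%:R :> R.
Proof.
move=> le_vD lt_aD; have D_gt0 : 0 < D%:R :> R by rewrite ltr0n; lia.
have [lt_va|le_av] := ltnP v a.
  have /eqP-> : (v - a == 0)%N by rewrite subn_eq0 ltnW.
  rewrite mul0r sub0r normrN ger0_norm ?divr_ge0 ?ler0n //.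
  by rewrite ler_pM2r ?invr_gt0 // ler_nat ltnW.
have Da_gt0 : 0 < (D - a)%:R :> R by rewrite ltr0n subn_gt0.
have -> : (v - a)%:R / (D - a)%:R - v%:R / D%:R =
    - (a%:R / D%:R * ((D - v)%:R / (D - a)%:R)) :> R.
  rewrite !natrB // 1?ltnW //; move: Da_gt0; rewrite natrB 1?ltnW // => Da_gt0.
  by field; rewrite !gt_eqF.
rewrite normrN ger0_norm ?mulr_ge0 ?invr_ge0 ?ler0n //.
rewrite ler_piMr ?divr_ge0 ?ler0n // ler_pdivrMr // mul1r ler_nat; lia.
Qed.

(** Passing from [a] to [a + 1] adds at most [a / D] to the error, and
    [a ^ 2 + a <= (a + 1) ^ 2]. *)
Lemma bernstein_coef_approx D a v : (v <= D)%N -> (a <= D)%N ->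
  `|bernstein_coef D a v - (v%:R / D%:R) ^+ a| <= (a ^ 2)%:R / D%:R.
Proof.
move=> le_vD; elim: a => [|a IHa] le_aD.
  by rewrite /bernstein_coef !bin0 expr0 divff ?oner_eq0 // subrr normr0 mul0r.
have {}IHa := IHa (ltnW le_aD); rewrite bernstein_coefS // exprSr.
have D_gt0 : 0 < D%:R :> R by rewrite ltr0n; lia.
have Da_gt0 : 0 < (D - a)%:R :> R by rewrite ltr0n subn_gt0.
have c_itv := bernstein_coef_itv le_vD (ltnW le_aD).
have r_itv : 0 <= (v%:R / D%:R : R) <= 1.
  by rewrite divr_ge0 ?ler0n //= ler_pdivrMr // mul1r ler_nat.
have ratio := ratio_approx le_vD le_aD.
set c := bernstein_coef D a v in IHa c_itv *.
set r := v%:R / D%:R in IHa r_itv ratio *.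
set s := (v - a)%:R / (D - a)%:R in ratio *.
clearbody c r s.
have -> : c * s - r ^+ a * r = (c - r ^+ a) * r + c * (s - r) by ring.
apply: le_trans (_ : (a ^ 2)%:R / D%:R + a%:R / D%:R <= _).
  rewrite (le_trans (ler_normD _ _)) // !normrM lerD //.
    case/andP: r_itv => r_ge0 r_le1; rewrite (ger0_norm r_ge0).
    by rewrite (le_trans _ IHa) // ler_piMr.
  case/andP: c_itv => c_ge0 c_le1; rewrite (ger0_norm c_ge0).
  by rewrite (le_trans _ ratio) // ler_piMl.
rewrite -mulrDl -natrD ler_pM2r ?invr_gt0 // ler_nat.
by rewrite -[in leqRHS]addn1 sqrnD; lia.
Qed.

(** The factors are exchanged one at a time; the remaining ones lie in [[0, 1]] and do not enlarge
    the difference. *)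
Lemma ler_dist_prod (I : Type) (r : seq I) (F G : I -> R) :
    (forall i, 0 <= F i <= 1) -> (forall i, 0 <= G i <= 1) ->
  `|\prod_(i <- r) F i - \prod_(i <- r) G i| <= \sum_(i <- r) `|F i - G i|.
Proof.
move=> F01 G01; elim: r => [|i r IHr]; first by rewrite !big_nil subrr normr0.
rewrite !big_cons; set P := \prod_(j <- r) F j in IHr *.
set Q := \prod_(j <- r) G j in IHr *.
have -> : F i * P - G i * Q = (F i - G i) * P + G i * (P - Q) by ring.
rewrite (le_trans (ler_normD _ _)) // !normrM lerD //.
  rewrite ler_piMr // ger0_norm ?prodr_ge0 // => [|j _].
    by apply: prodr_ile1 => j _; exact: F01.
  by case/andP: (F01 j).
have /andP[Gi_ge0 Gi_le1] := G01 i.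
by rewrite (ger0_norm Gi_ge0) (le_trans _ IHr) // ler_piMl.
Qed.

(** The tensor-product Bernstein polynomial. Its arguments [x i] are themselves polynomials, so that
    the basis in [n] variables can be carried into [{mpoly R[n + m]}]. *)
Definition bernstein N n (x : 'I_n -> {mpoly R[N]}) D
    (nu : {ffun 'I_n -> 'I_D.+1}) :=
  \prod_(i < n) ('C(D, nu i)%:R *: (x i ^+ nu i * (1 - x i) ^+ (D - nu i))).

Definition mbernstein_coef n (q : {mpoly R[n]}) D
    (nu : {ffun 'I_n -> 'I_D.+1}) : R :=
  \sum_(u <- msupp q) q@_u * \prod_(i < n) bernstein_coef D (u i) (nu i).

Lemma msupp_exponent_le n (q : {mpoly R[n]}) u i D :
  u \in msupp q -> (msize q <= D.+1)%N -> (u i <= D)%N.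
Proof.
move=> /msize_mdeg_lt lt_uq le_qD; rewrite -ltnS (leq_trans _ le_qD) //.
by rewrite (leq_ltn_trans _ lt_uq) // mdegE (bigD1 i) //= leq_addr.
Qed.

(** The univariate expansion is applied to each power in each monomial, and the product of sums is
    distributed over the multi-indices [nu]. *)
Lemma comp_mpoly_bernstein N n (q : {mpoly R[n]})
    (x : n.-tuple {mpoly R[N]}) D :
    (msize q <= D.+1)%N ->
  q \mPo x = \sum_(nu : {ffun 'I_n -> 'I_D.+1})
               mbernstein_coef q nu *: bernstein (tnth x) nu.
Proof.
move=> le_qD; rewrite comp_mpolyEX.
under [RHS]eq_bigr do rewrite scaler_suml.
rewrite exchange_big /= big_seq_cond [RHS]big_seq_cond.
apply: eq_bigr => u /andP[uq _].
have le_uD i : (u i <= D)%N := msupp_exponent_le i uq le_qD.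
under [RHS]eq_bigr do rewrite -scalerA.
rewrite -scaler_sumr comp_mpolyX; congr (_ *: _).
under eq_bigr do rewrite (exprn_bernstein _ (le_uD _)).
rewrite bigA_distr_bigA /=; apply: eq_bigr => nu _.
rewrite /bernstein -scaler_prod; apply: eq_bigr => i _.
by rewrite scalerA.
Qed.

(** The numerator depends on [q] alone, so the estimate is [O(1/D)] uniformly over the grid. *)
Lemma mbernstein_coef_approx n (q : {mpoly R[n]}) D
    (nu : {ffun 'I_n -> 'I_D.+1}) :
    (msize q <= D.+1)%N ->
  `|mbernstein_coef q nu - q.@[fun i => (nu i)%:R / D%:R]| <=
    (\sum_(u <- msupp q) `|q@_u| * \sum_(i < n) (u i ^ 2)%:R) / D%:R.
Proof.
move=> le_qD; rewrite mevalE -sumrB mulr_suml.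
rewrite (le_trans (ler_norm_sum _ _ _)) //.
rewrite big_seq_cond [leRHS]big_seq_cond; apply: ler_sum => u /andP[uq _].
have le_uD i : (u i <= D)%N := msupp_exponent_le i uq le_qD.
have le_nuD i : (nu i <= D)%N by rewrite -ltnS.
rewrite -mulrBr normrM -mulrA ler_wpM2l // mulr_suml.
have r_itv i : 0 <= ((nu i)%:R / D%:R : R) ^+ u i <= 1.
  have r_ge0 : 0 <= (nu i)%:R / D%:R :> R by rewrite divr_ge0 ?ler0n.
  rewrite exprn_ge0 //= exprn_ile1 //.
  (* For [D = 0] the quotient is [0], the inverse of [0] being [0] by convention. *)
  case: D {le_qD le_uD} nu le_nuD r_ge0 => [|D] nu le_nuD _.
    by rewrite invr0 mulr0.
  by rewrite ler_pdivrMr ?ltr0n // mul1r ler_nat.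
apply: le_trans (ler_dist_prod _ _ r_itv) _ => [i|].
  exact: bernstein_coef_itv.
by apply: ler_sum => i _; exact: bernstein_coef_approx.
Qed.

End Bernstein.

(** * Linear forms in the errors *)

Section LinearInErrors.
Variables (R : realType) (n m : nat).
Implicit Types (j : 'I_m) (k : nat) (u w : 'I_n -> nat).
Local Notation vx i := ('X_(lshift m i) : {mpoly R[n + m]}).
Local Notation ve j := ('X_(rshift n j) : {mpoly R[n + m]}).

Definition xvars : n.-tuple {mpoly R[n + m]} := [tuple vx i | i < n].

Definition linear_form (s : 'I_m -> {mpoly R[n]}) : {mpoly R[n + m]} :=
  \sum_(j < m) (s j \mPo xvars) * ve j.

Definition extend u (g : nat) : 'X_{1..n + 1} :=
  [multinom (if fintype.split i is inl i' then u i' else g) | i < n + 1].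

Lemma mdeg_extend u g : mdeg (extend u g) = (\sum_(i < n) u i + g)%N.
Proof.
rewrite mdegE big_split_ord big_ord1 /= mnmE (unsplitK (inr ord0)).
by congr (_ + _)%N; apply: eq_bigr => i _; rewrite mnmE (unsplitK (inl i)).
Qed.

Lemma hprod_extend j u w g d :
  hprod R j (extend u g) (extend w d) =
    (\prod_(i < n) vx i ^+ u i) * (\prod_(i < n) (1 - vx i) ^+ w i) *
    ((2^-1)%:MP + 2^-1 *: ve j) ^+ g * ((2^-1)%:MP - 2^-1 *: ve j) ^+ d.
Proof.
rewrite /hprod !mnmE !(unsplitK (inr ord0)); congr (_ * _ * _ * _).
  by apply: eq_bigr => i _; rewrite mnmE (unsplitK (inl i)).
by apply: eq_bigr => i _; rewrite mnmE (unsplitK (inl i)).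
Qed.

Definition xprod u w : {mpoly R[n + m]} :=
  (\prod_(i < n) vx i ^+ u i) * (\prod_(i < n) (1 - vx i) ^+ w i).

(** An error-free product is a generator attached to any index [j], with both error exponents
    [0]. *)
Lemma sparse_cone_xprod j k u w :
  (\sum_(i < n) u i + \sum_(i < n) w i <= k)%N -> sparse_cone k (xprod u w).
Proof.
move=> le_k; have -> : xprod u w = hprod R j (extend u 0) (extend w 0).
  by rewrite hprod_extend !expr0 !mulr1.
by apply: sparse_cone_hprod; rewrite mdegD !mdeg_extend !addn0.
Qed.

(* [|c| + c e] is [2 |c| (1/2 + e/2)] or [2 |c| (1/2 - e/2)]. *)
Lemma sparse_cone_xprod_linear j k u w (c : R) :
  (\sum_(i < n) u i + \sum_(i < n) w i < k)%N ->
  sparse_cone k (`|c| *: xprod u w + c *: (xprod u w * ve j)).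
Proof.
move=> lt_k; have mC : (2^-1)%:MP = 2^-1 *: 1 :> {mpoly R[n + m]}.
  by rewrite -[RHS]mul_mpolyC mulr1.
have [c_ge0|c_lt0] := leP 0 c.
  have -> : `|c| *: xprod u w + c *: (xprod u w * ve j) =
      (2 * c) *: hprod R j (extend u 1) (extend w 0).
    rewrite hprod_extend expr0 mulr1 expr1 mC -scalerDr -scalerAr scalerA.
    rewrite ger0_norm // [2 * c]mulrC mulfK ?pnatr_eq0 //.
    by rewrite mulrDr mulr1 scalerDr.
  apply: sparse_coneZ; first by rewrite mulr_ge0.
  by apply: sparse_cone_hprod; rewrite mdegD !mdeg_extend; lia.
have -> : `|c| *: xprod u w + c *: (xprod u w * ve j) =
    (2 * - c) *: hprod R j (extend u 0) (extend w 1).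
  rewrite hprod_extend expr0 mulr1 expr1 mC -scalerBr -scalerAr scalerA.
  rewrite ltr0_norm // [2 * - c]mulrC mulfK ?pnatr_eq0 // mulrBr mulr1 scalerBr.
  by rewrite !scaleNr opprK.
apply: sparse_coneZ; first by rewrite mulr_ge0 // oppr_ge0 ltW.
by apply: sparse_cone_hprod; rewrite mdegD !mdeg_extend; lia.
Qed.

End LinearInErrors.

(** * Feasible points of the lower programs *)

Section Feasibility.
Variables (R : realType) (n m : nat) (s : 'I_m -> {mpoly R[n]}).
Implicit Types (j : 'I_m) (k : nat).
Local Notation vx i := ('X_(lshift m i) : {mpoly R[n + m]}).
Local Notation ve j := ('X_(rshift n j) : {mpoly R[n + m]}).
Local Notation xmon := (@xprod R n m).
Local Notation xs := (xvars R n m).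
Local Notation l := (linear_form s).

Lemma comp_xvarsX (u : 'X_{1..n}) : 'X_[u] \mPo xs = xmon u (fun=> 0%N).
Proof.
rewrite comp_mpolyX /xprod [X in _ * X]big1 ?mulr1 //.
by apply: eq_bigr => i _; rewrite tnth_mktuple.
Qed.

(* Induction through [1 - x^v x_i = (1 - x^v) + x^v (1 - x_i)]. *)
Lemma sparse_cone_one_sub_monomial j k (u : 'X_{1..n}) :
  (mdeg u <= k)%N -> sparse_cone k (1 - ('X_[u] \mPo xs)).
Proof.
elim: {u}(mdeg u) {-2}u (erefl (mdeg u)) => [|d IHd] u.
  move=> /eqP; rewrite mdeg_eq0 => /eqP-> _.
  by rewrite mpolyX0 comp_mpoly1 subrr; exact: sparse_cone0.
move=> mdeg_u le_k; have /existsP[i ui] : [exists i, u i != 0%N].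
  apply: contra_eqT mdeg_u => /existsPn u0.
  by rewrite mdegE big1 // => i _; apply/eqP/negPn/u0.
rewrite -lep1mP in ui; have uE := submK ui.
set v := (u - U_(i))%MM in uE; have mdeg_v : mdeg v = d.
  by move: mdeg_u; rewrite -uE mdegD mdeg1; lia.
have -> : 1 - ('X_[u] \mPo xs) =
    (1 - ('X_[v] \mPo xs)) + xmon v (U_(i)%MM : 'X_{1..n}).
  have -> : xmon v (U_(i)%MM : 'X_{1..n}) = ('X_[v] \mPo xs) * (1 - vx i).
    rewrite comp_mpolyX /xprod; congr (_ * _).
      by apply: eq_bigr => i' _; rewrite tnth_mktuple.
    rewrite (bigD1 i) //= mnm1E eqxx expr1 big1 ?mulr1 // => i' ni.
    by rewrite mnm1E eq_sym (negPf ni) expr0.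
  rewrite -uE mpolyXD rmorphM /= comp_mpolyXU -tnth_nth tnth_mktuple.
  by rewrite mulrBr mulr1 addrA subrK.
apply: sparse_coneD; first by apply: IHd => //; lia.
by apply: (sparse_cone_xprod _ j); rewrite -!mdegE mdeg1; lia.
Qed.

(** The error takes exactly one unit of degree, so [mdeg u] is below the degree of the form, which
    leaves room for one error factor already at order [degree l]. *)
Lemma msupp_linear_form M : M \in msupp l ->
  exists j (u : 'X_{1..n}),
    'X_[M] = ('X_[u] \mPo xs) * ve j /\ mdeg M = (mdeg u).+1.
Proof.
move=> /msupp_sum_le/flatten_mapP[j _]; rewrite comp_mpolyEX mulr_suml.
move=> /msupp_sum_le/flatten_mapP[u _]; rewrite -scalerAl => /msuppZ_le.
pose M' := (\sum_(i < n) U_(lshift m i) *+ u i + U_(rshift n j))%MM.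
have -> : ('X_[u] \mPo xs) * ve j = 'X_[M'].
  rewrite mpolyXD -mprodXnE comp_mpolyX; congr (_ * _).
  by apply: eq_bigr => i _; rewrite tnth_mktuple.
rewrite msuppX mem_seq1 => /eqP->; exists j, u; split.
  rewrite mpolyXD -mprodXnE comp_mpolyX; congr (_ * _).
  by apply: eq_bigr => i _; rewrite tnth_mktuple.
rewrite mdegD mdeg_sum mdeg1 addn1 [mdeg u]mdegE; congr _.+1.
by apply: eq_bigr => i _; rewrite mdegMn mdeg1 mul1n.
Qed.

(** Each term [c x^u e_j] is completed by [|c|], and their sum splits as
    [(|c| x^u + c x^u e_j) + |c| (1 - x^u)], where both summands lie in the cone. *)
Lemma lp_lower_set_nonempty k :
  (0 < m)%N -> (degree l <= k)%N -> lp_lower_set l k !=set0.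
Proof.
move=> m_gt0 le_k; exists (- \sum_(M <- msupp l) `|l@_M|).
suff : sparse_cone k (l - (- \sum_(M <- msupp l) `|l@_M|)%:MP) by [].
rewrite mpolyCN opprK [X in X + _]mpolyE raddf_sum /= -big_split /=.
rewrite big_seq_cond; apply: sparse_cone_sum => M /andP[Ml _].
have [j [u [XM mdeg_M]]] := msupp_linear_form Ml.
have le_uk : (mdeg u < k)%N.
  rewrite -mdeg_M (leq_trans _ le_k) // /degree.
  by have := msize_mdeg_lt Ml; lia.
have -> : l@_M *: 'X_[M] + `|l@_M|%:MP =
    (`|l@_M| *: xmon u (fun=> 0%N) + l@_M *: (xmon u (fun=> 0%N) * ve j)) +
    `|l@_M| *: (1 - ('X_[u] \mPo xs)).
  rewrite XM -comp_xvarsX scalerBr alg_mpolyC.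
  by rewrite addrACA [X in _ = X + _]addrC addrA; ring.
apply: sparse_coneD.
  by apply: sparse_cone_xprod_linear; rewrite -mdegE big1 // addn0.
apply: sparse_coneZ => //.
by apply: (sparse_cone_one_sub_monomial j); exact: ltnW.
Qed.

Lemma meval_linear_form v : l.@[v] =
  \sum_(j < m) (s j).@[fun i => v (lshift m i)] * v (rshift n j).
Proof.
rewrite raddf_sum; apply: eq_bigr => j _ /=.
rewrite mevalM mevalXU comp_mpoly_meval; congr (_ * _).
by apply: meval_eq => i; rewrite tnth_mktuple mevalXU.
Qed.

Lemma lp_lower_set_approx mu : (0 < m)%N -> (forall v, box v -> mu <= l.@[v]) ->
  exists C, forall D, (0 < D)%N -> (forall j, msize (s j) <= D.+1)%N ->
    lp_lower_set l (n * D).+1 (mu - C / D%:R).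
Proof.
move=> m_gt0 mu_le; have j0 : 'I_m := Ordinal m_gt0.
(* [C j / D] bounds the distance from the Bernstein coefficients of [s j] to its grid values; [C j]
   does not depend on [D]. *)
pose C j := \sum_(u <- msupp (s j)) `|(s j)@_u| * \sum_(i < n) (u i ^ 2)%:R.
exists (\sum_(j < m) C j) => D D_gt0 le_sD; set t := mu - _.
suff : sparse_cone (n * D).+1 (l - t%:MP) by [].
pose c j (nu : {ffun 'I_n -> 'I_D.+1}) := mbernstein_coef (s j) nu.
pose B (nu : {ffun 'I_n -> 'I_D.+1}) := bernstein (tnth xs) nu.
pose K (nu : {ffun 'I_n -> 'I_D.+1}) : R := \prod_(i < n) 'C(D, nu i)%:R.
have BE nu : B nu = K nu *: xmon (fun i => nu i) (fun i => D - nu i)%N.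
  rewrite /B /bernstein scaler_prod big_split /=; congr (_ *: (_ * _)).
    by apply: eq_bigr => i _; rewrite tnth_mktuple.
  by apply: eq_bigr => i _; rewrite tnth_mktuple.
have K_ge0 nu : 0 <= K nu by apply: prodr_ge0.
(* A Bernstein product has total degree [n * D]; one error factor brings the order to
   [n * D + 1]. *)
have mdeg_nu (nu : {ffun 'I_n -> 'I_D.+1}) :
    (\sum_(i < n) nu i + \sum_(i < n) (D - nu i) = n * D)%N.
  rewrite -big_split /= -[in RHS](card_ord n) -sum_nat_const.
  by apply: eq_bigr => i _; rewrite subnKC // -ltnS.
(* Partition of unity, read off from the Bernstein expansion of [1]. *)
have sum_B : \sum_nu B nu = 1.
  rewrite -(comp_mpoly1 xs) (@comp_mpoly_bernstein R _ _ 1 xs D) ?msize1 //.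
  apply: eq_bigr => nu _; rewrite /mbernstein_coef msupp1 big_seq1 mcoeff1 eqxx.
  rewrite mul1r big1 ?scale1r // => i _.
  by rewrite mnm0E /bernstein_coef !bin0 divff ?oner_eq0.
have -> : l - t%:MP = \sum_nu (\sum_(j < m)
    (`|c j nu| *: B nu + c j nu *: (B nu * ve j)) +
    (- t - \sum_(j < m) `|c j nu|) *: B nu).
  rewrite -[t%:MP]mulr1 mul_mpolyC -sum_B scaler_sumr.
  have -> : l = \sum_nu \sum_(j < m) c j nu *: (B nu * ve j).
    rewrite exchange_big /=; apply: eq_bigr => j _.
    rewrite (comp_mpoly_bernstein _ (le_sD j)) mulr_suml.
    by apply: eq_bigr => nu _; rewrite -scalerAl.
  rewrite -sumrB; apply: eq_bigr => nu _.
  rewrite big_split /= -scaler_suml [(- t - _) *: _]scalerBl scaleNr.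
  by ring.
have sum_c nu : \sum_(j < m) `|c j nu| <= - t.
  (* The worst errors at the grid point [nu / D] attain [- \sum_j |s_j|]. *)
  pose x i : R := (nu i)%:R / D%:R.
  pose v (i : 'I_(n + m)) := match fintype.split i with
    | inl i' => x i' | inr j => - Num.sg (s j).@[x] end.
  have vl i : v (lshift m i) = x i by rewrite /v (unsplitK (inl i)).
  have vr j : v (rshift n j) = - Num.sg (s j).@[x].
    by rewrite /v (unsplitK (inr j)).
  have v_box : box v.
    split=> [i|j].
      rewrite vl /x divr_ge0 //= ler_pdivrMr ?ltr0n // mul1r ler_nat.
      by rewrite -ltnS.
    by rewrite vr -ler_norml normrN normr_sg; case: eqP => //= _; exact: ler01.
  have := mu_le _ v_box; rewrite meval_linear_form.
  under eq_bigr => j _.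
    rewrite vr (@meval_eq _ _ _ x _ vl) mulrN mulrC -normrEsg.
    over.
  rewrite sumrN /t opprB lerNr => mu_le'.
  rewrite mulr_suml.
  (* Coefficient and grid value differ by at most [C j / D], and the absolute grid values sum to at
     most [- mu] by [mu_le']. *)
  apply: (@le_trans _ _ (\sum_(j < m) (C j / D%:R + `|(s j).@[x]|)));
    last first.
    by rewrite big_split /= lerD.
  apply: ler_sum => j _; rewrite -lerBlDr (le_trans (lerB_dist _ _)) //.
  exact: mbernstein_coef_approx.
apply: sparse_cone_sum => nu _; apply: sparse_coneD.
  apply: sparse_cone_sum => j _.
  rewrite BE -scalerAl !scalerA ![_ * K nu]mulrC -!scalerA -scalerDr.
  apply: sparse_coneZ => //; apply: sparse_cone_xprod_linear.
  by rewrite mdeg_nu.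
rewrite BE scalerA; apply: sparse_coneZ.
  by rewrite mulr_ge0 // subr_ge0 sum_c.
by apply: (sparse_cone_xprod _ j0); rewrite mdeg_nu.
Qed.

End Feasibility.

(** * Convergence of the hierarchy *)

Lemma cvg_maxr (R : realType) (T : Type) (F : set_system T) {FF : Filter F}
    (f g : T -> R) (a b : R) :
  f @ F --> a -> g @ F --> b -> Num.max (f x) (g x) @[x --> F] --> Num.max a b.
Proof.
move=> fa gb; rewrite maxr_absE; under eq_fun do rewrite maxr_absE.
exact: cvgM (cvgD (cvgD fa gb) (cvg_norm (cvgB fa gb))) (cvg_cst _).
Qed.

Section Hierarchy.
Variables (R : realType) (n m : nat).
Hypothesis m_gt0 : (0 < m)%N.
Implicit Types (s : 'I_m -> {mpoly R[n]}) (q : {mpoly R[n + m]}) (S : set R).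

Lemma is_max_sup S v : is_max S v -> sup S = v.
Proof.
move=> [Sv ubv]; apply/eqP; rewrite eq_le.
by rewrite ge_sup ?ub_le_sup //; exists v.
Qed.

Lemma is_max_opp S v : is_max [set - x | x in S] (- v) <-> is_min S v.
Proof.
split=> -[]; rewrite /is_min /is_max.
  move=> [x Sx /oppr_inj xv] ub; rewrite -xv; split=> // y Sy.
  by rewrite -lerN2 xv; apply: ub; exists y.
move=> Sv lb; split; first by exists v.
by move=> _ [y Sy <-]; rewrite lerN2 lb.
Qed.

(** Up to sign, the upper program of [q] is the lower program of [- q]. As linear forms are stable
    under negation, the upper hierarchy follows from the lower one. *)
Lemma lp_upper_setN q k :
  lp_upper_set q k = [set - t | t in lp_lower_set (- q) k].
Proof.
apply/seteqP; split=> [t [lam [lam_ge0 tE]]|_ [t [lam [lam_ge0 tE]] <-]].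
  by exists (- t); rewrite ?opprK //; exists lam; rewrite mpolyCN opprK addrC.
by exists lam; rewrite mpolyCN addrC.
Qed.

Lemma box_valuesN q : box_values q = [set - x | x in box_values (- q)].
Proof.
apply/seteqP; split=> [_ [v vB <-]|_ [_ [v vB <-] <-]].
  by exists (- q).@[v]; [exists v|rewrite mevalN opprK].
by exists v; rewrite // mevalN opprK.
Qed.

Lemma lp_upperN q k : lp_upper q k = - lp_lower (- q) k.
Proof. by rewrite /lp_upper /inf lp_upper_setN setNK. Qed.

Lemma l_minN q : l_min q = - l_max (- q).
Proof. by rewrite /l_min /inf box_valuesN setNK. Qed.

Lemma l_max_attained q : is_max (box_values q) (l_max q).
Proof.
have [v vB v_max] := box_maximum q.
have max_v : is_max (box_values q) q.@[v].
  by split; [exists v|move=> _ [w wB <-]; exact: v_max].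
by rewrite /l_max (is_max_sup max_v).
Qed.

Lemma l_min_attained q : is_min (box_values q) (l_min q).
Proof.
apply/is_max_opp; rewrite l_minN opprK.
by rewrite box_valuesN setNK; exact: l_max_attained.
Qed.

(** Since [q] lies between [l_min q] and [l_max q], its absolute value is largest at a minimizer or
    at a maximizer. *)
Lemma l_absmax_attained q :
  is_max (box_abs_values q) (Num.max `|l_min q| `|l_max q|).
Proof.
have [[v vB v_min] lb_min] := l_min_attained q.
have [[w wB w_max] ub_max] := l_max_attained q.
split=> [|_ [u uB <-]].
  by case: leP => _; [exists w|exists v]; rewrite // (v_min, w_max).
have := lb_min _ (imageP _ uB); have := ub_max _ (imageP _ uB).
rewrite le_max /= => le_u ge_u.
case: ger0P => _; first by rewrite (le_trans le_u (ler_norm _)) orbT.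
by rewrite -(normrN (l_min q)) (le_trans _ (ler_norm _)) // lerN2.
Qed.

Lemma l_absmaxE q : l_absmax q = Num.max `|l_min q| `|l_max q|.
Proof. exact: is_max_sup (l_absmax_attained q). Qed.

Lemma lp_lower_set_ub q k t v : lp_lower_set q k t -> box v -> t <= q.@[v].
Proof.
move=> tP vB; have := sparse_cone_ge0 (tP : sparse_cone k _) vB.
by rewrite mevalB mevalC subr_ge0.
Qed.

(** The nested sums are flattened to one finite index, and the program is evaluated at the box
    center, with [eps = 2^-k]. *)
Lemma lp_lower_set_max q k : lp_lower_set q k !=set0 ->
  exists t, is_max (lp_lower_set q k) t.
Proof.
pose M : finType := bmultinom (n + 1) k.+1.
pose I : finType := ('I_m * M * M)%type.
pose P (x : I) := (mdeg (x.1.2 + x.2)%MM <= k)%N.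
pose h (x : I) := hprod R x.1.1 x.1.2 x.2.
have phiE (lam : weights R n m) :
    \sum_(j < m) phi k lam j = \sum_(x | P x) lam x.1.1 x.1.2 x.2 *: h x.
  by rewrite /phi pair_big /= pair_big_dep.
have -> : lp_lower_set q k = program_set P h q.
  apply/seteqP; split=> t [lam [lam_ge0 tE]].
    exists (fun x : I => lam x.1.1 x.1.2 x.2); rewrite -phiE; split=> // x Px.
    exact: lam_ge0.
  (* Weights are total functions; beyond the bounded multi-indices they default to [0], a value that
     [phi] never reads. *)
  exists (fun j a b => if (insub a, insub b) is (Some a', Some b')
                       then lam (j, a', b') else 0).
  split=> [j a b le_k|].
    case: insubP => // a' _ aE; case: insubP => // b' _ bE.
    by apply: lam_ge0; rewrite /P /= aE bE.
  by rewrite phiE tE; apply: eq_bigr => -[[j a] b] _ /=; rewrite !valK.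
move=> ne; have [||t tP t_ub] := @program_set_max R I P _ h q
  (@box_center R n m) (2^-1 ^+ k) _ _ ne; last by exists t.
  by rewrite exprn_gt0 ?invr_gt0.
move=> x Px; rewrite meval_hprod_center ler_wiXn2l //; lra.
Qed.

(** * Monotonicity and convergence of the lower values *)

Section Lower.
Variable s : 'I_m -> {mpoly R[n]}.
Let l := linear_form s.

Lemma lp_lower_max k : (degree l <= k)%N ->
  is_max (lp_lower_set l k) (lp_lower l k).
Proof.
move=> le_k.
have [t t_max] := lp_lower_set_max (lp_lower_set_nonempty m_gt0 le_k).
by rewrite /lp_lower (is_max_sup t_max).
Qed.

Lemma lp_lower_le k k' : (degree l <= k)%N -> (k <= k')%N ->
  lp_lower l k <= lp_lower l k'.
Proof.
move=> le_k le_k'; apply: (lp_lower_max (leq_trans le_k le_k')).2.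
exact: (sparse_cone_le le_k' (lp_lower_max le_k).1).
Qed.

(** The values never exceed [l_min l]. From order [n * D + 1] on they are at least
    [l_min l - C / D], with [D] fixed in advance so that [C / D <= e]. *)
Lemma lp_lower_cvg : lp_lower l k @[k --> \oo] --> l_min l.
Proof.
have [[v vB v_min] lb_min] := l_min_attained l.
have lp_le k : (degree l <= k)%N -> lp_lower l k <= l_min l.
  move=> /lp_lower_max[lowerP _]; rewrite -v_min.
  exact: lp_lower_set_ub lowerP vB.
have [C CP] : exists C, forall D, (0 < D)%N ->
    (forall j, msize (s j) <= D.+1)%N ->
    lp_lower_set l (n * D).+1 (l_min l - C / D%:R).
  by apply: lp_lower_set_approx => // w wB; apply: lb_min; exists w.
pose D0 := (\max_(j < m) msize (s j))%N.
apply/cvgrPdist_le => e e_gt0.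
have [D [D_gt0 le_sD le_CD]] : exists D, [/\ (0 < D)%N,
    (forall j, msize (s j) <= D.+1)%N & C / D%:R <= e].
  pose N := Num.bound `|C / e|.
  (* [N] takes care of [C / D <= e], and [D0] makes the degree large enough to expand every
     [s j]. *)
  exists (maxn N D0).+1; split=> // [j|].
    have le_D0 : (msize (s j) <= D0)%N by exact: leq_bigmax.
    by rewrite (leq_trans le_D0) //; lia.
  rewrite ler_pdivrMr ?ltr0n // mulrC -ler_pdivrMr //.
  rewrite (le_trans (ler_norm _)) // ltW // (lt_le_trans (archi_boundP _)) //.
  by rewrite ler_nat leqW // leq_maxl.
near=> k; have le_k : (degree l <= k)%N by near: k; exact: nbhs_infty_ge.
rewrite ger0_norm ?subr_ge0 ?lp_le // lerBlDr -lerBlDl.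
apply: (le_trans (lerB (lexx _) le_CD)); apply: (lp_lower_max le_k).2.
apply: sparse_cone_le (CP D D_gt0 le_sD).
by near: k; exact: nbhs_infty_ge.
Unshelve. all: by end_near.
Qed.

End Lower.

Lemma linear_formN s : - linear_form s = linear_form (fun j => - s j).
Proof.
rewrite /linear_form -sumrN; apply: eq_bigr => j _.
by rewrite comp_mpolyN mulNr.
Qed.

Lemma degreeN q : degree (- q) = degree q.
Proof. by rewrite /degree msizeN. Qed.

Lemma lp_upper_min s k : let l := linear_form s in (degree l <= k)%N ->
  is_min (lp_upper_set l k) (lp_upper l k).
Proof.
move=> /= le_k; apply/is_max_opp; rewrite lp_upper_setN setNK lp_upperN opprK.
by rewrite linear_formN; apply: lp_lower_max; rewrite -linear_formN degreeN.
Qed.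

Theorem linear_form_hierarchy s : let l := linear_form s in let d := degree l in
  [/\ is_min (box_values l) (l_min l),
      is_max (box_values l) (l_max l),
      is_max (box_abs_values l) (l_absmax l) &
      forall k : nat, (d <= k)%N ->
        is_max (lp_lower_set l k) (lp_lower l k) /\
        is_min (lp_upper_set l k) (lp_upper l k)] /\
  [/\ forall k k' : nat, (d <= k)%N -> (k <= k')%N ->
        lp_lower l k <= lp_lower l k',
      lp_lower l k @[k --> \oo] --> l_min l,
      forall k k' : nat, (d <= k)%N -> (k <= k')%N ->
        lp_upper l k' <= lp_upper l k,
      lp_upper l k @[k --> \oo] --> l_max l &
      lp_abs l k @[k --> \oo] --> l_absmax l].
Proof.
move=> l d; have l_maxE : l_max l = - l_min (- l) by rewrite l_minN !opprK.
have lower_cvg : lp_lower l k @[k --> \oo] --> l_min l by exact: lp_lower_cvg.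
have upper_cvg : lp_upper l k @[k --> \oo] --> l_max l.
  rewrite l_maxE; under eq_fun do rewrite lp_upperN.
  by apply: cvgN; rewrite /l linear_formN; exact: lp_lower_cvg.
split; split=> //.
- exact: l_min_attained.
- exact: l_max_attained.
- by rewrite l_absmaxE; exact: l_absmax_attained.
- by move=> k le_k; split; [exact: lp_lower_max|exact: lp_upper_min].
- exact: lp_lower_le.
- move=> k k' le_k le_k'; rewrite !lp_upperN lerN2.
  suff le_d : (degree (- l) <= k)%N.
    by rewrite /l linear_formN in le_d *; exact: lp_lower_le le_d le_k'.
  by rewrite degreeN.
- by rewrite l_absmaxE; apply: cvg_maxr; exact: cvg_norm.
Qed.

End Hierarchy.

Theorem lemma3 (R : realType) (n p : nat) (c : 'I_p -> R) (f : expr n p) :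
  let l' := linpart c f in
  let d := degree l' in
  (* all the minima and maxima in the definitions are attained *)
  [/\ is_min (box_values l') (l_min l'),
      is_max (box_values l') (l_max l'),
      is_max (box_abs_values l') (l_absmax l') &
      forall k : nat, (d <= k)%N ->
        is_max (lp_lower_set l' k) (lp_lower l' k) /\
        is_min (lp_upper_set l' k) (lp_upper l' k)] /\
  [/\ forall k k' : nat, (d <= k)%N -> (k <= k')%N ->
        lp_lower l' k <= lp_lower l' k',
      lp_lower l' k @[k --> \oo] --> l_min l',
      forall k k' : nat, (d <= k)%N -> (k <= k')%N ->
        lp_upper l' k' <= lp_upper l' k,
      lp_upper l' k @[k --> \oo] --> l_max l' &
      lp_abs l' k @[k --> \oo] --> l_absmax l'].
Proof.
(* An expression is a variable, a constant or an operation, and each of these brings an error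
   variable. *)
have nerr_gt0 : (0 < nerr f)%N.
  rewrite /nerr; case: f => [i|i|o a b] /=; last by rewrite addnS.
    by case: i => i; lia.
  by case: i => i; lia.
(* By conversion, [linpart c f] is the linear form with coefficients [sens c f]. *)
exact: (linear_form_hierarchy nerr_gt0 (@sens R n p c f)).
Qed.
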